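(* Let $T_l$ be a $2m$ deck-shuffler IET and let $H_l:[0,1)\to[0,1)$, $H_l(x)=\sum_{n=0}^\infty \chi_B(T_l^n x)/2^{n+1}$, and $\mu_l=(H_l)_*\mathrm{Leb}$. Then: (a) $E_2\circ H_l=H_l\circ T_l$ on $[0,1)$; (b) $\mu_l$ is $E_2$-invariant (more generally $(H_l)_*\nu$ is $E_2$-invariant for every $T_l$-invariant Borel probability measure $\nu$); (c) $H_l$ is right-continuous; (d) $H_l$ is non-decreasing; (e) for $z\in[0,1)$, $\mu_l(\{z\})>0$ if and only if $H_l^{-1}(\{z\})$ is an interval of positive length; in that case there is a positive integer $n$ with $T_l^n(x)=x$ for all $x\in H_l^{-1}(\{z\})$. Conversely, if $a<b$ and there is a positive integer $n$ with $T_l^n(x)=x$ for all $x\in[a,b]$, then $H_l([a,b])$ is a finite set; (f) if $T_l$ is minimal, then $H_l$ is strictly increasing, and hence is an injective right-continuous map intertwining $T_l$ with $E_2$.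
   Context: $E_2(x)=2x\bmod1$ on $[0,1)\cong\mathbb{R}/\mathbb{Z}$. A $2m$ deck-shuffler IET $T_l$ is the map $[0,1)\to[0,1)$ determined by a length vector $l$ giving a partition of $[0,1)$ into consecutive left-closed right-open intervals $A_1<\dots<A_m<B_1<\dots<B_m$ of positive lengths, with $T_l(x)=x+|B_1|+\dots+|B_i|$ for $x\in A_i$ and $T_l(x)=x-|A_i|-\dots-|A_m|$ for $x\in B_i$. $B=B_1\cup\dots\cup B_m$, $\chi_B$ is its indicator function, and Leb is Lebesgue measure on $[0,1)$. $T_l$ is minimal if every orbit is dense in $[0,1)$. *)

(* Defs.v *)
From HB Require Import structures.
From mathcomp Require Import all_boot all_order all_algebra.
From mathcomp Require Import all_classical all_reals all_analysis.
Set Implicit Arguments. Unset Strict Implicit. Unset Printing Implicit Defensive.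
Import Order.TTheory GRing.Theory Num.Theory.
Import numFieldNormedType.Exports.
Local Open Scope classical_set_scope.
Local Open Scope ring_scope.

Section DeckShuffler.
Variable R : realType.

(* partial sums: SA a k = |A_0| + ... + |A_(k-1)| (0-based indices) *)
Definition psum (m : nat) (a : 'I_m -> R) (k : nat) : R :=
  \sum_(j < m | (j < k)%N) a j.

Definition valid_lengths (m : nat) (a b : 'I_m -> R) : Prop :=
  (0 < m)%N /\ (forall i, 0 < a i) /\ (forall i, 0 < b i) /\
  psum a m + psum b m = 1.

Definition alphaA (m : nat) (a : 'I_m -> R) : R := psum a m.

Definition inA (m : nat) (a : 'I_m -> R) (i : 'I_m) (x : R) : bool :=
  (psum a i <= x) && (x < psum a i.+1).

Definition inB (m : nat) (a b : 'I_m -> R) (i : 'I_m) (x : R) : bool :=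
  (alphaA a + psum b i <= x) && (x < alphaA a + psum b i.+1).

(* The deck-shuffler IET T_l (identity outside [0,1)).
   On A_i : x + |B_1|+...+|B_i| ; on B_i : x - (|A_i|+...+|A_m|). *)
Definition dsT (m : nat) (a b : 'I_m -> R) (x : R) : R :=
  match [pick i : 'I_m | inA a i x] with
  | Some i => x + psum b i.+1
  | None =>
    match [pick i : 'I_m | inB a b i x] with
    | Some i => x - (alphaA a - psum a i)
    | None => x
    end
  end.

Definition chiB (m : nat) (a b : 'I_m -> R) (x : R) : R :=
  ([exists i : 'I_m, inB a b i x] : bool)%:R.

Definition Hl (m : nat) (a b : 'I_m -> R) (x : R) : R :=
  limn (series (fun n : nat => chiB a b (iter n (dsT a b) x) / 2 ^+ n.+1)).

Definition E2 (x : R) : R := 2 * x - (Num.floor (2 * x))%:~R.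

Definition muL (m : nat) (a b : 'I_m -> R) : set R -> \bar R :=
  pushforward (fun A : set R => (@lebesgue_measure R) (`[0, 1[ `&` A)) (Hl a b).

Definition minimalT (m : nat) (a b : 'I_m -> R) : Prop :=
  forall x y : R, 0 <= x < 1 -> 0 <= y < 1 -> forall e : R, 0 < e ->
    exists n : nat, `|iter n (dsT a b) x - y| < e.

End DeckShuffler.

(* Main.v *)
(** Since [H x = (chi x + H (T x)) / 2] with [chi] valued in {0, 1}, and since an
    orbit cannot stay in B forever (T moves points of B to the left by at least
    |A_m|), [H < 1] on all orbits; so H intertwines T with doubling and H x
    determines the itinerary of x. On A and on B separately, T is increasing and
    never shrinks distances, hence H is monotone and distances between points of
    a fibre of H do not decrease along orbits. If x < y lie in one fibre, the
    pigeonhole principle gives i < j with T^i x and T^j x at distance less than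
    y - x, so that T^i x and T^j x are in the same fibre K; then T^(j-i) maps K
    to itself without shrinking distances, which in a bounded set forces it to be
    the identity on K, and injectivity of T pulls this back to the fibre of x. *)

Require Import Defs.
From HB Require Import structures.
From mathcomp Require Import all_boot all_order all_algebra.
From mathcomp Require Import all_classical all_reals all_analysis.
From mathcomp Require Import ring lra.
Set Implicit Arguments. Unset Strict Implicit. Unset Printing Implicit Defensive.
Import Order.TTheory GRing.Theory Num.Theory.
Import numFieldNormedType.Exports.
Local Open Scope classical_set_scope.
Local Open Scope ring_scope.

(** * Translation invariance of Lebesgue measure *)

Lemma measurable_translation (R : realType) (c : R) :
  measurable_fun setT (fun x : R => x + c).
Proof. by apply: measurable_realfun.nondecreasing_measurable => // x y xy; rewrite lerD2r. Qed.

(** The pushforward of Lebesgue measure under a translation gives half-open intervals their length,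
    and these values determine the measure. *)
Lemma lebesgue_measure_translation (R : realType) (c : R) A : measurable A ->
  lebesgue_measure ((fun x : R => x + c) @^-1` A) = lebesgue_measure A.
Proof.
move=> mA; pose f (x : measurableTypeR R) : measurableTypeR R := x + c.
have mf : measurable_fun setT f := measurable_translation c.
apply/esym; rewrite -[RHS]/(pushforward lebesgue_measure f A).
apply: lebesgue_measure_unique => // _ [[x y] _ <-] /=; rewrite /pushforward.
have -> : f @^-1` `]x, y] = `]x - c, y - c]%classic.
  by apply/seteqP; split => z /=; rewrite !in_itv /= ltrBlDr lerBrDr.
rewrite !lebesgue_measure_itv /= !lte_fin ltrD2r -!EFinD.
by rewrite (_ : y - c - (x - c) = y - x) //; ring.
Qed.

(** * Partial sums of lengths and the intervals they delimit *)

Section PartialSums.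
Context {R : realType} {m : nat} (a : 'I_m -> R).

Lemma psum0 : psum a 0 = 0.
Proof. by rewrite /psum big_pred0. Qed.

Lemma psumS (i : 'I_m) : psum a i.+1 = psum a i + a i.
Proof.
rewrite /psum (bigD1 i) //= addrC; congr (_ + _); apply: eq_bigl => j.
by rewrite ltnS [RHS]ltn_neqAle andbC.
Qed.

Hypothesis a_gt0 : forall i, 0 < a i.

Lemma psum_le j k : (j <= k)%N -> psum a j <= psum a k.
Proof.
move=> jk; rewrite /psum big_mkcond [leRHS]big_mkcond /=; apply: ler_sum => i _.
have := a_gt0 i; case: ifPn => ij; case: ifPn => ik // /ltW //.
by rewrite (leq_trans ij jk) in ik.
Qed.

Lemma psum_ge0 k : 0 <= psum a k.
Proof. by rewrite -psum0 psum_le. Qed.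

Lemma inA_exists x : 0 <= x < psum a m -> exists i, inA a i x.
Proof.
move=> /andP[x0 xm].
suff : forall k, (k <= m)%N -> x < psum a k -> exists i, inA a i x by apply; first exact: leqnn.
elim=> [|k IH] km xk; first by move: xk; rewrite psum0 ltNge x0.
have [xk'|xk'] := ltP x (psum a k); first exact: IH (ltnW km) xk'.
by exists (Ordinal km); rewrite /inA xk'.
Qed.

Lemma inA_le i j x y : inA a i x -> inA a j y -> x <= y -> (i <= j)%N.
Proof.
move=> /andP[ix _] /andP[_ yj] xy; rewrite leqNgt; apply/negP => /psum_le ji.
by move: (lt_le_trans yj ji); rewrite ltNge (le_trans ix xy).
Qed.

Lemma inA_inj i j x : inA a i x -> inA a j x -> i = j.
Proof.
by move=> xi xj; apply/val_inj/eqP; rewrite eqn_leq (inA_le xi xj) // (inA_le xj xi).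
Qed.

Lemma inA_range i x : inA a i x -> 0 <= x < psum a m.
Proof.
move=> /andP[ix xi]; rewrite (le_trans (psum_ge0 i) ix) /=.
exact: lt_le_trans xi (psum_le (ltn_ord i)).
Qed.

End PartialSums.

(** * Elementary facts about real sequences and finite sets of reals *)

Section RealLemmas.
Context {R : realType}.

Lemma half_exp_small (e : R) : 0 < e -> exists n, 2^-1 ^+ n < e.
Proof.
move=> e0; exists (Num.bound e^-1).
rewrite exprVn -[ltRHS]invrK ltf_pV2 ?posrE ?exprn_gt0 ?invr_gt0 //.
exact: upper_nthrootP.
Qed.

(** A positive [c] would push [u] more than 2 beyond [u 0] after 2 / c steps. This is how orbits
    confined to [0, 1) are shown not to move steadily in one direction. *)
Lemma bounded_drift (u : nat -> R) (c : R) : (forall k, c <= u k.+1 - u k) ->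
  (forall k, `|u k| <= 1) -> c <= 0.
Proof.
move=> step bnd; rewrite leNgt; apply/negP => c0.
have ukc k : u 0%N + k%:R * c <= u k.
  by elim: k => [|k IH]; [rewrite mul0r addr0|have := step k; rewrite -natr1; lra].
have := archi_boundP (divr_ge0 (ler0n R 2) (ltW c0)); rewrite ltr_pdivrMr //.
set k := Num.bound _; have := ukc k; have := bnd 0%N; have := bnd k.
by rewrite !ler_norml; lra.
Qed.

(** Serves to show that a finite orbit cannot be dense. *)
Lemma notin_seq_dist (s : seq R) y : y \notin s ->
  exists2 e, 0 < e & forall z, z \in s -> e <= `|z - y|.
Proof.
elim: s => [_|z s IH]; first by exists 1.
rewrite inE negb_or => /andP[yz /IH[e e0 he]].
exists (Num.min e `|z - y|); first by rewrite lt_min e0 normr_gt0 subr_eq0 eq_sym.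
by move=> t; rewrite inE ge_min => /orP[/eqP->|/he ->] //; rewrite lexx orbT.
Qed.

End RealLemmas.

(** * The map T on its pieces: order, expansion and injectivity *)

Section DeckShuffler.
Context {R : realType} {m : nat} {a b : 'I_m -> R}.
Hypothesis lengths_ab : valid_lengths a b.
Local Notation T := (dsT a b).
Local Notation chi := (chiB a b).
Local Notation H := (Hl a b).
Local Notation al := (alphaA a).
Local Notation sa := (psum a).
Local Notation sb := (psum b).

Let a_gt0 i : 0 < a i. Proof. by case: lengths_ab => _ []. Qed.
Let b_gt0 i : 0 < b i. Proof. by case: lengths_ab => _ [_ []]. Qed.
Let sum1 : al + sb m = 1. Proof. by case: lengths_ab => _ [_ [_]]. Qed.
Let m_gt0 : (0 < m)%N. Proof. by case: lengths_ab. Qed.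

(** B_i is the i-th interval for the lengths [b], moved right by [al]; the lemmas on [inA], stated
    for arbitrary lengths, thus apply to B as well. *)
Lemma inBE i x : inB a b i x = inA b i (x - al).
Proof. by rewrite /inB /inA lerBrDl ltrBlDl. Qed.

Lemma inB_range {i x} : inB a b i x -> al <= x < 1.
Proof.
rewrite inBE => /(inA_range b_gt0); rewrite subr_ge0 -sum1 => /andP[-> /=].
by rewrite ltrBlDl.
Qed.

Lemma inA_inBF {i j x} : inA a i x -> inB a b j x = false.
Proof.
move=> /(inA_range a_gt0)/andP[_ x_al]; apply/negP => /inB_range/andP[].
by rewrite leNgt x_al.
Qed.

Lemma chiB_inA {i x} : inA a i x -> chi x = 0.
Proof.
by move=> xi; rewrite /chiB; case: existsP => // -[j]; rewrite (inA_inBF xi).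
Qed.

Lemma chiB_inB {i x} : inB a b i x -> chi x = 1.
Proof. by move=> xi; rewrite /chiB; case: existsP => // -[]; exists i. Qed.

Lemma dsT_inA {i x} : inA a i x -> T x = x + sb i.+1.
Proof.
move=> xi; rewrite /dsT; case: pickP => [j xj|/(_ i)]; last by rewrite xi.
by rewrite (inA_inj a_gt0 xi xj).
Qed.

Lemma dsT_inB {i x} : inB a b i x -> T x = x - (al - sa i).
Proof.
move=> xi; rewrite /dsT; case: pickP => [j xj|_]; first by rewrite (inA_inBF xj) in xi.
case: pickP => [j xj|/(_ i)]; last by rewrite xi.
by rewrite !inBE in xi xj; rewrite (inA_inj b_gt0 xi xj).
Qed.

Variant piece_spec (x : R) : Prop :=
| PieceA i of inA a i x
| PieceB i of inB a b i x.

Lemma pieceP x : 0 <= x < 1 -> piece_spec x.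
Proof.
move=> /andP[x0 x1]; have [x_al|al_x] := ltP x al.
  by have [|i] := @inA_exists _ _ a x; [rewrite x0|exact: PieceA].
have [|i] := @inA_exists _ _ b (x - al); first by rewrite subr_ge0 al_x ltrBlDl sum1.
by rewrite -inBE; exact: PieceB.
Qed.

Lemma piece_range x : piece_spec x -> 0 <= x < 1.
Proof.
have al0 : 0 <= al := psum_ge0 a_gt0 m.
case=> i.
  move=> /(inA_range a_gt0) /andP[-> /= xm]; rewrite (lt_le_trans xm) //.
  by rewrite -sum1 lerDl psum_ge0.
by move=> /inB_range /andP[? ->]; rewrite (le_trans al0).
Qed.

Lemma dsT_out x : ~~ (0 <= x < 1) -> T x = x.
Proof.
move=> nx; rewrite /dsT; case: pickP => [i xi|_].
  by rewrite piece_range // in nx; exact: PieceA xi.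
by case: pickP => // i xi; rewrite piece_range // in nx; exact: PieceB xi.
Qed.

Lemma chiB_out x : ~~ (0 <= x < 1) -> chi x = 0.
Proof.
move=> nx; rewrite /chiB; case: existsP => // -[i xi].
by rewrite piece_range // in nx; exact: PieceB xi.
Qed.

Lemma chiB01 x : chi x = 0 \/ chi x = 1.
Proof. by rewrite /chiB; case: [exists _, _]; [right|left]. Qed.

Lemma dsT_range x : 0 <= x < 1 -> 0 <= T x < 1.
Proof.
case/pieceP => i xi.
  rewrite (dsT_inA xi); case/andP: (xi) => ix xi'; case/andP: (inA_range a_gt0 xi) => x0 xal.
  have := psum_ge0 b_gt0 i.+1; have := @psum_le _ _ _ b_gt0 i.+1 m (ltn_ord i).
  move: sum1; rewrite /alphaA in xal *; lra.
rewrite (dsT_inB xi); case/andP: (xi) => ix xi'.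
have := psum_ge0 a_gt0 i; have := psum_ge0 b_gt0 i.
have := @psum_le _ _ _ b_gt0 i.+1 m (ltn_ord i); have := @psum_le _ _ _ a_gt0 i m (ltnW (ltn_ord i)).
by move: sum1 ix xi'; rewrite /alphaA; lra.
Qed.

Lemma iter_range x n : 0 <= x < 1 -> 0 <= iter n T x < 1.
Proof. by move=> x01; elim: n => //= n; exact: dsT_range. Qed.

Lemma chiB_le x y : 0 <= x < 1 -> 0 <= y < 1 -> x <= y -> chi x <= chi y.
Proof.
move=> /pieceP[] i xi /pieceP[] j yj xy.
- by rewrite (chiB_inA xi) (chiB_inA yj).
- by rewrite (chiB_inA xi) (chiB_inB yj).
- case/andP: (inB_range xi) => xal _; case/andP: (inA_range a_gt0 yj) => _ yal.
  by move: (le_lt_trans xal (le_lt_trans xy yal)); rewrite ltxx.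
- by rewrite (chiB_inB xi) (chiB_inB yj).
Qed.

(** On A the displacement [sb i.+1] grows with i, and so does [sa i - al] on B: within one side, a
    point further right is moved at least as far to the right. *)
Lemma dsT_expand x y : 0 <= x < 1 -> 0 <= y < 1 -> x <= y -> chi x = chi y ->
  y - x <= T y - T x.
Proof.
move=> /pieceP[] i xi /pieceP[] j yj xy.
- move=> _; have ij := inA_le a_gt0 xi yj xy.
  rewrite (dsT_inA xi) (dsT_inA yj).
  have := @psum_le _ _ _ b_gt0 i.+1 j.+1 ij; lra.
- by rewrite (chiB_inA xi) (chiB_inB yj) => /eqP; rewrite eq_sym oner_eq0.
- by rewrite (chiB_inB xi) (chiB_inA yj) => /eqP; rewrite oner_eq0.
- move=> _; rewrite (dsT_inB xi) (dsT_inB yj).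
  have ij : (i <= j)%N.
    by rewrite !inBE in xi yj; apply: (inA_le b_gt0 xi yj); rewrite lerD2r.
  have := @psum_le _ _ _ a_gt0 i j ij; lra.
Qed.

(** T interleaves the two halves: the image of B_j is [[sa j + sb j], [sa j + sb j.+1]) and that of
    A_i is [[sa i + sb i.+1], [sa i.+1 + sb i.+1]). So the image of B_j lies to the left of that of
    A_i if j <= i, and to its right otherwise. *)
Lemma dsT_inA_neq_inB x y i j : inA a i x -> inB a b j y -> T x != T y.
Proof.
move=> xi yj; rewrite (dsT_inA xi) (dsT_inB yj).
case/andP: xi => ix xi; case/andP: yj => jy yj; rewrite /alphaA in jy yj *.
have [ji|ij] := leqP j i.
  have := @psum_le _ _ _ a_gt0 j i ji; have := @psum_le _ _ _ b_gt0 j.+1 i.+1 ji.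
  by move=> ? ?; rewrite gt_eqF //; lra.
have := @psum_le _ _ _ a_gt0 i.+1 j ij; have := @psum_le _ _ _ b_gt0 i.+1 j ij.
by move=> ? ?; rewrite lt_eqF //; lra.
Qed.

Lemma dsT_inj x y : 0 <= x < 1 -> 0 <= y < 1 -> T x = T y -> x = y.
Proof.
wlog xy : x y / x <= y => [hw x01 y01 Txy|].
  by have [/hw|/ltW/hw h] := leP x y; [exact|apply/esym/h].
move=> x01 y01 Txy.
suff chixy : chi x = chi y.
  have := dsT_expand x01 y01 xy chixy; rewrite Txy subrr subr_le0 => yx.
  by apply/eqP; rewrite eq_le xy.
case: (pieceP x01) (pieceP y01) => i xi [] j yj.
- by rewrite (chiB_inA xi) (chiB_inA yj).
- by move: (dsT_inA_neq_inB xi yj); rewrite Txy eqxx.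
- by move: (dsT_inA_neq_inB yj xi); rewrite Txy eqxx.
- by rewrite (chiB_inB xi) (chiB_inB yj).
Qed.

Lemma iter_inj n x y : 0 <= x < 1 -> 0 <= y < 1 -> iter n T x = iter n T y -> x = y.
Proof.
move=> x01 y01; elim: n => //= n IH /dsT_inj h; apply/IH/h; exact: iter_range.
Qed.

Lemma dsT_drop_on_B : exists2 e, 0 < e & forall x, chi x = 1 -> T x <= x - e.
Proof.
have m1 : (m.-1 < m)%N by rewrite ltn_predL.
(* Every displacement |A_i| + ... + |A_m| on B contains the last term |A_m|. *)
exists (a (Ordinal m1)) => // x; rewrite /chiB.
case: existsP => [[i xi] _|_ /eqP]; last by rewrite eq_sym oner_eq0.
rewrite (dsT_inB xi); have im : (i <= m.-1)%N by rewrite -ltnS prednK.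
have := @psum_le _ _ _ a_gt0 i m.-1 im; have := psumS a (Ordinal m1).
rewrite /alphaA /= prednK //; lra.
Qed.

(** Pieces are closed on the left and open on the right, so [d] can be the distance from x to the
    right end of its piece. This is the source of the right-continuity of H. *)
Lemma dsT_right_translation x : 0 <= x < 1 ->
  exists2 d, 0 < d & forall y, x <= y < x + d ->
    [/\ 0 <= y < 1, chi y = chi x & T y = T x + (y - x)].
Proof.
case/pieceP => i xi.
  exists (sa i.+1 - x); first by case/andP: xi; rewrite subr_gt0.
  move=> y /andP[xy yd]; have yi : inA a i y.
    case/andP: xi => ix xi; rewrite /inA (le_trans ix xy) /=; lra.
  rewrite (chiB_inA xi) (chiB_inA yi) (dsT_inA xi) (dsT_inA yi); split => //; last lra.
  by apply: piece_range; exact: PieceA yi.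
exists (al + sb i.+1 - x); first by case/andP: xi; rewrite subr_gt0.
move=> y /andP[xy yd]; have yi : inB a b i y.
  case/andP: xi => ix xi; rewrite /inB (le_trans ix xy) /=; lra.
rewrite (chiB_inB xi) (chiB_inB yi) (dsT_inB xi) (dsT_inB yi); split => //; last lra.
by apply: piece_range; exact: PieceB yi.
Qed.


(** * The series H, its functional equation and the semiconjugacy with doubling *)

Let H_term x n : 0 <= chi (iter n T x) / 2 ^+ n.+1 <= geometric 2^-1 2^-1 n.
Proof.
rewrite /= exprVn -invfM -exprS; have := exprn_gt0 n.+1 (ltr0n R 2).
by rewrite -invr_gt0 => /ltW; case: (chiB01 (iter n T x)) => ->; rewrite ?mul0r ?mul1r ?lexx => ->.
Qed.

Lemma Hl_cvg x : series (fun n => chi (iter n T x) / 2 ^+ n.+1) @ \oo --> H x.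
Proof.
apply: (@series_le_cvg _ _ (geometric 2^-1 2^-1)) => [n|n|n|].
- by case/andP: (H_term x n).
- by case/andP: (H_term x n) => *; apply: le_trans; eassumption.
- by case/andP: (H_term x n).
- by apply: is_cvg_geometric_series; rewrite ger0_norm ?invr_ge0 // invf_lt1 // ltr1n.
Qed.

Lemma Hl_ge0 x : 0 <= H x.
Proof.
apply: limr_ge; first exact: cvgP (@Hl_cvg x).
by near=> n; apply: sumr_ge0 => i _; case/andP: (H_term x i).
Unshelve. all: by end_near. Qed.

Lemma Hl_le1 x : H x <= 1.
Proof.
have h : `|2^-1 : R| < 1 by rewrite ger0_norm ?invr_ge0 // invf_lt1 // ltr1n.
have /cvg_lim e := @cvg_geometric_series R 2^-1 2^-1 h.
have -> : 1 = limn (series (geometric (2^-1 : R) 2^-1)) by rewrite e //; field.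
apply: lim_series_le; [exact: cvgP (@Hl_cvg x)|exact: is_cvg_geometric_series|].
by move=> n; case/andP: (H_term x n).
Qed.

(** Splitting off the term n = 0 leaves half of the series of [T x]. Nearly everything about H below
    is derived from this equation. *)
Lemma HlE x : H x = (chi x + H (T x)) / 2.
Proof.
rewrite [LHS]/Hl; apply/cvg_lim => //; rewrite -cvg_shiftS /=.
have -> : (fun n => series (fun n => chi (iter n T x) / 2 ^+ n.+1) n.+1) =
   (fun n => (chi x + series (fun n => chi (iter n T (T x)) / 2 ^+ n.+1) n) / 2).
  apply/funext => n; rewrite /series /= !big_mkord big_ord_recl /= expr1 mulrDl mulr_suml.
  congr (_ + _); apply: eq_bigr => i _.
  by rewrite /bump /= add1n -iterS iterSr -mulrA -invfM -exprSr.
apply: cvgMr_tmp; apply: cvgD; [exact: cvg_cst|exact: Hl_cvg].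
Qed.

(** The value 1 would propagate along the orbit and keep it in B forever. Strictness excludes
    expansions consisting only of ones, so that the first digit [chi x] can be read off from
    [H x]. *)
Lemma Hl_lt1 x : H x < 1.
Proof.
rewrite lt_neqAle Hl_le1 andbT; apply/eqP => Hx1.
have H1 y : H y = 1 -> chi y = 1 /\ H (T y) = 1.
  by move=> Hy; have := HlE y; have := Hl_le1 (T y); case: (chiB01 y) => ->; lra.
have Hn n : H (iter n T x) = 1 by elim: n => //= n /H1[].
have [x01|/chiB_out x0] := boolP (0 <= x < 1); last first.
  by case: (H1 _ Hx1) => /eqP; rewrite x0 eq_sym oner_eq0.
have [e e0 drop] := dsT_drop_on_B.
have : e <= 0; last by rewrite leNgt e0.
apply: (@bounded_drift _ (fun n => - iter n T x)) => n; last first.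
  by rewrite normrN ler_norml; have := iter_range n x01; lra.
by have := drop _ (H1 _ (Hn n)).1; rewrite /=; lra.
Qed.

Lemma E2_Hl x : E2 (H x) = H (T x).
Proof.
rewrite /E2; have -> : 2 * H x = chi x + H (T x) by rewrite HlE; field.
(* As [H (T x)] lies in [0, 1), the integer part of the sum is the digit [chi x]. *)
suff -> : Num.floor (chi x + H (T x)) = (chi x == 1)%:Z.
  by case: (chiB01 x) => ->; rewrite ?eqxx ?(eq_sym 0) ?oner_eq0 /=; lra.
apply/eqP; rewrite floor_eq intrD; have := Hl_ge0 (T x); have := Hl_lt1 (T x).
by case: (chiB01 x) => ->; rewrite ?eqxx ?(eq_sym 0) ?oner_eq0 /=; lra.
Qed.

Lemma iter_E2_Hl n x : iter n (@E2 R) (H x) = H (iter n T x).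
Proof. by elim: n => //= n ->; rewrite E2_Hl. Qed.

Lemma Hl_inj_chiB x y : H x = H y -> chi x = chi y.
Proof.
rewrite (HlE x) (HlE y); move: (Hl_ge0 (T x)) (Hl_lt1 (T x)) (Hl_ge0 (T y)) (Hl_lt1 (T y)).
by case: (chiB01 x) => ->; case: (chiB01 y) => ->; lra.
Qed.


(** * Monotonicity and right-continuity of H *)

Lemma Hl_le_approx n x y : 0 <= x < 1 -> 0 <= y < 1 -> x <= y ->
  H x <= H y + 2^-1 ^+ n.
Proof.
(* The error halves with each binary digit. If the digits of x and y agree, T keeps their order and
   the induction continues; if they differ, then H x <= 1/2 <= H y. *)
elim: n x y => [|n IH] x y x01 y01 xy.
  by rewrite expr0; have := Hl_le1 x; have := Hl_ge0 y; lra.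
rewrite (HlE x) (HlE y) exprS; have := chiB_le x01 y01 xy.
have := Hl_ge0 (T y); have := Hl_le1 (T x); have : 0 < 2^-1 ^+ n :> R by rewrite exprn_gt0 // invr_gt0.
have [chixy|] := eqVneq (chi x) (chi y).
  have Txy : T x <= T y by have := dsT_expand x01 y01 xy chixy; lra.
  have := IH _ _ (dsT_range x01) (dsT_range y01) Txy; rewrite chixy; lra.
by case: (chiB01 x) => ->; case: (chiB01 y) => ->; rewrite ?eqxx //; lra.
Qed.

Lemma Hl_le x y : 0 <= x < 1 -> 0 <= y < 1 -> x <= y -> H x <= H y.
Proof.
move=> x01 y01 xy; apply/ler_addgt0Pr => e /half_exp_small[n ne].
by apply: le_trans (Hl_le_approx n x01 y01 xy) _; rewrite lerD2l ltW.
Qed.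

(** Just to the right of x the map T is a translation with constant digit, so an estimate at [T x]
    pulls back to x with half the error; the radius is the smaller of the two available. *)
Lemma Hl_right_approx n x : 0 <= x < 1 ->
  exists2 d, 0 < d & forall y, x <= y < x + d -> `|H x - H y| <= 2^-1 ^+ n.
Proof.
elim: n x => [|n IH] x x01.
  exists 1 => // y _; rewrite expr0 ler_norml.
  by have := Hl_ge0 x; have := Hl_le1 x; have := Hl_ge0 y; have := Hl_le1 y; lra.
have [d1 d10 h1] := dsT_right_translation x01.
have [d2 d20 h2] := IH _ (dsT_range x01).
exists (Num.min d1 d2); first by rewrite lt_min d10.
move=> y /andP[xy]; rewrite -ltrBlDl lt_min => /andP[yd1 yd2].
have [|_ chixy Txy] := h1 y; first by rewrite xy -ltrBlDl.
have : `|H (T x) - H (T y)| <= 2^-1 ^+ n by apply: h2; lra.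
rewrite (HlE x) (HlE y) chixy exprS !ler_norml; lra.
Qed.

Lemma Hl_right_continuous x : 0 <= x < 1 -> H y @[y --> x^'+] --> H x.
Proof.
move=> x01; apply/cvgrPdist_lt => e /half_exp_small[n ne].
have [d d0 hd] := Hl_right_approx n x01.
near=> y; apply: le_lt_trans ne; apply: hd; apply/andP; split.
  by apply: ltW; near: y; exact: nbhs_right_gt.
by near: y; apply: nbhs_right_lt; rewrite ltrDl.
Unshelve. all: by end_near. Qed.

(** * Fibres of H and periodicity *)

Section Plateau.
Variables (x y : R).
Hypotheses (x01 : 0 <= x < 1) (y01 : 0 <= y < 1) (Hxy : H x = H y).

Lemma plateau_iter n : H (iter n T x) = H (iter n T y).
Proof. by rewrite -!iter_E2_Hl Hxy. Qed.

(** Points of one fibre share their itinerary, so [dsT_expand] applies at every step. *)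
Lemma plateau_expand n : x <= y -> y - x <= iter n T y - iter n T x.
Proof.
move=> xy; elim: n => //= n IH; apply: (le_trans IH).
apply: dsT_expand; [exact: iter_range|exact: iter_range| |exact/Hl_inj_chiB/plateau_iter].
by rewrite -subr_ge0; apply: le_trans IH; rewrite subr_ge0.
Qed.

End Plateau.

(** Along [u k], the image of x under k rounds of T^p, each increment is at least as large in
    modulus as the first and has the same sign. Boundedness therefore forces the first increment to
    vanish; the case of a move to the left uses - u. *)
Lemma plateau_iter_fixed p x : 0 <= x < 1 -> H (iter p T x) = H x -> iter p T x = x.
Proof.
move=> x01 Hp; pose u k := iter (k * p)%N T x.
have uS k : u k.+1 = iter (k * p)%N T (iter p T x) by rewrite /u mulSnr iterD.
have u_lt1 k : `|u k| <= 1.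
  by rewrite ler_norml; have := iter_range (k * p)%N x01; rewrite -/(u k); lra.
have p01 := iter_range p x01.
have [xp|px] := leP x (iter p T x).
  have : iter p T x - x <= 0.
    by apply: (@bounded_drift _ u) => // k; rewrite uS;
      exact: (plateau_expand x01 p01 (esym Hp) _ xp).
  by move=> ?; apply/eqP; rewrite eq_le xp andbT -subr_le0.
have : x - iter p T x <= 0; last by move: px; lra.
apply: (@bounded_drift _ (\- u)) => [k|k] /=; last by rewrite normrN.
by rewrite uS; have := plateau_expand p01 x01 Hp (k * p) (ltW px); rewrite -/(u k); lra.
Qed.


Lemma plateau_periodic x y : 0 <= x < 1 -> 0 <= y < 1 -> x < y -> H x = H y ->
  exists2 p, (0 < p)%N & forall z, 0 <= z < 1 -> H z = H x -> iter p T z = z.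
Proof.
move=> x01 y01 xy Hxy.
(* If T^p returns the fibre of T^i x to itself, it fixes T^i z for every z in the fibre of x, and
   injectivity of T^i cancels T^i. *)
suff [i [p [p_gt0 Hip]]] : exists i p, (0 < p)%N /\ H (iter (p + i) T x) = H (iter i T x).
  exists p => // z z01 Hz; apply: (@iter_inj i) => //; first exact: iter_range.
  rewrite -iterD addnC iterD; apply: plateau_iter_fixed; first exact: iter_range.
  by rewrite -iterD !(=^~ iter_E2_Hl) Hz !iter_E2_Hl.
have [N NE] : exists N : nat, 1 < N%:R * (y - x).
  exists (Num.bound (y - x)^-1); rewrite -ltr_pdivrMr ?subr_gt0 // div1r.
  by apply: archi_boundP; rewrite invr_ge0 subr_ge0 ltW.
have N0 : (0 < N)%N by case: N NE => //; rewrite mul0r ltr10.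
(* Pigeonhole on the cells [k / N, (k + 1) / N[, each shorter than y - x. *)
have cell k : exists i : 'I_N, i%:R <= N%:R * iter k T x < i%:R + 1.
  have /andP[k0 k1] := iter_range k x01.
  have kN0 : 0 <= N%:R * iter k T x by rewrite mulr_ge0.
  have /andP[tl tu] := Num.Theory.truncn_itv kN0.
  have tN : (Num.truncn (N%:R * iter k T x) < N)%N.
    rewrite -(ltr_nat R); apply: le_lt_trans tl _; rewrite gtr_pMr ?ltr0n //.
  by exists (Ordinal tN); rewrite /= tl natr1 tu.
have [c cP] := choice cell.
have /injectivePn[i [j ij cij]] : ~~ injectiveb (fun k : 'I_N.+1 => c k).
  apply/negP => /injectiveP /leq_card; rewrite !card_ord ltnn //.
wlog ltij : i j ij cij / (i < j)%N => [hw|].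
  case: (ltngtP i j) => [/hw|/hw|/val_inj eij]; [exact|apply; rewrite // eq_sym //|].
  by rewrite eij eqxx in ij.
exists i, (j - i)%N; rewrite subn_gt0 ltij subnK 1?ltnW //; split => //.
(* Being in one cell, T^v x is within y - x to the right of T^u x, hence lies between T^u x and T^u
   y, two points of one fibre. Monotonicity of H then puts it in that fibre. *)
have close u v : c u = c v -> iter u T x <= iter v T x ->
    H (iter u T x) = H (iter v T x).
  move=> cuv uv; have := plateau_expand x01 y01 Hxy u (ltW xy) => exp.
  have /andP[cu1 cu2] := cP u; have /andP[cv1 cv2] := cP v; rewrite -cuv in cv1 cv2.
  have vy : iter v T x <= iter u T y.
    suff : iter v T x - iter u T x <= y - x by lra.
    rewrite -(ler_pM2l (_ : 0 < N%:R)) ?ltr0n // mulrBr; lra.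
  apply/eqP; rewrite eq_le (Hl_le _ _ uv) ?iter_range //=.
  by rewrite (plateau_iter Hxy u) Hl_le ?iter_range.
case: (leP (iter i T x) (iter j T x)) => [|/ltW]; first by move/(close i j cij).
by move/(close j i (esym cij)).
Qed.

(** If T^n x = x, then 2^n H x = j + H x with an integer 0 <= j < 2^n, so H x is one of the finitely
    many numbers j / (2^n - 1). *)
Lemma periodic_Hl_finite c d n : (0 < n)%N ->
  (forall x, c <= x <= d -> iter n T x = x) -> finite_set (H @` `[c, d]).
Proof.
move=> n0 fixn.
have Hn k x : exists2 j, (j < 2 ^ k)%N & 2 ^+ k * H x = j%:R + H (iter k T x).
  elim: k => [|k [j jk IH]]; first by exists 0%N; rewrite // mul1r add0r.
  (* The integer j has as binary digits the first k values of [chi] along the orbit; the next one is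
     appended. *)
  exists (j.*2 + (chi (iter k T x) == 1%R))%N.
    rewrite expnS mul2n; apply: leq_trans (_ : j.+1.*2 <= _)%N; last by rewrite leq_double.
    by rewrite doubleS; case: (_ == _); rewrite /= ?addn0 ?addn1.
  rewrite exprS -mulrA IH (HlE (iter k T x)) natrD -muln2 natrM iterS.
  by case: (chiB01 (iter k T x)) => ->; rewrite ?eqxx ?(eq_sym 0) ?oner_eq0 /=; field.
apply: (@sub_finite_set _ _ ((fun j : nat => j%:R / (2 ^+ n - 1)) @` `I_(2 ^ n))).
  move=> _ [x /= xcd <-]; have [j jn jE] := Hn n x.
  exists j => //; rewrite fixn in jE; last by rewrite in_itv in xcd.
  have n2 : 2 ^+ n - 1 != 0 :> R by rewrite gt_eqF // subr_gt0 exprn_egt1 -?lt0n // ltr1n.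
  by apply: (mulIf n2); rewrite mulfVK // mulrBr mulr1 [_ * 2 ^+ n]mulrC jE; lra.
exact/finite_image/finite_II.
Qed.

(** A periodic orbit is a finite list, and a point off the list stays at positive distance from it;
    density would thus put all of [0, 1) into the list. *)
Lemma periodic_not_dense p x : (0 < p)%N -> 0 <= x < 1 -> iter p T x = x ->
  ~ minimalT a b.
Proof.
move=> p0 x01 px min.
pose orb := [seq iter k T x | k <- iota 0 p].
have orbP k : iter k T x \in orb.
  rewrite (divn_eq k p) addnC iterD; have -> : iter (k %/ p * p) T x = x.
    by elim: (k %/ p)%N => //= q IH; rewrite mulSnr iterD px.
  by apply: map_f; rewrite mem_iota ltn_mod.
have in_orb y : 0 <= y < 1 -> y \in orb.
  move=> y01; apply/negPn/negP => y_orb.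
  have [e e0 he] := notin_seq_dist y_orb.
  have [k] := min x y x01 y01 e e0.
  by rewrite ltNge he.
(* These p + 1 distinct points of [0, 1) are one too many for a list of length p. *)
pose s : seq R := [seq k%:R / p.+1%:R | k <- iota 0 p.+1].
have : (size s <= size orb)%N.
  apply: uniq_leq_size.
    rewrite map_inj_uniq ?iota_uniq // => i j /(mulIf _) ij.
    by apply/eqP; rewrite -(eqr_nat R) ij // invr_eq0 pnatr_eq0.
  move=> _ /mapP[k + ->]; rewrite mem_iota => /andP[_ kp]; apply: in_orb.
  by rewrite divr_ge0 //= ltr_pdivrMr ?ltr0n // mul1r ltr_nat.
by rewrite !size_map !size_iota ltnn.
Qed.

Lemma minimal_Hl_lt x y : minimalT a b -> 0 <= x < 1 -> 0 <= y < 1 -> x < y -> H x < H y.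
Proof.
move=> min x01 y01 xy; rewrite lt_neqAle (Hl_le x01 y01 (ltW xy)) andbT.
apply/eqP => Hxy; have [p p0 /(_ x x01 erefl) px] := plateau_periodic x01 y01 xy Hxy.
exact: periodic_not_dense p0 x01 px min.
Qed.

(** * Measurability of H and T, and invariance of Lebesgue measure under T *)

Local Notation I01 := (`[0 : R, 1[%classic).

Lemma measurable_Hl_preimage A : measurable A -> measurable (I01 `&` H @^-1` A).
Proof.
(* H vanishes outside [0, 1), hence need not be monotone on the line. Replacing its values by 1 on
   the right gives a monotone, hence measurable, function that agrees with H on [0, 1). *)
move=> mA; pose G x := if x < 0 then 0 else if x < 1 then H x else 1.
have G_nd : nondecreasing_fun G.
  move=> x y xy; rewrite /G; have [x0|x0] := ltP x 0.
    by case: ifP => // _; case: ifP => // _; exact: Hl_ge0.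
  rewrite (ltNge y 0) (le_trans x0 xy) /=; have [x1|x1] := ltP x 1.
    by case: ifP => y1; [apply: Hl_le; rewrite ?x0 ?x1 ?y1 ?(le_trans x0 xy)|exact: Hl_le1].
  by rewrite (ltNge y 1) (le_trans x1 xy).
suff -> : I01 `&` H @^-1` A = I01 `&` G @^-1` A.
  by apply: (measurable_realfun.nondecreasing_measurable _ G_nd).
by apply/seteqP; split => x [/=]; rewrite in_itv /= /G => /andP[x0 x1]; rewrite (ltNge x 0) x0 x1.
Qed.

(** There the functional equation reads H x = H x / 2. *)
Lemma Hl_out x : ~~ (0 <= x < 1) -> H x = 0.
Proof. by move=> x_out; have := HlE x; rewrite dsT_out // chiB_out //; lra. Qed.

(** Outside [0, 1) the preimage is everything or nothing, according to whether A contains 0. The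
    preimage in the whole line is the set to which invariance of a measure under T is applied. *)
Lemma measurable_Hl_preimageT A : measurable A -> measurable (H @^-1` A).
Proof.
move=> mA; have -> : H @^-1` A = (I01 `&` H @^-1` A) `|` (~` I01 `&` [set _ | A 0]).
  apply/seteqP; split => x /=; rewrite in_itv /=.
    move=> Ax; have [x01|x_out] := boolP (0 <= x < 1); [by left|right].
    by split => //; rewrite -(Hl_out x_out).
  by case=> [[]//|[/negP x_out]]; rewrite Hl_out.
apply: measurableU; first exact: measurable_Hl_preimage.
have [A0|nA0] := pselect (A 0).
  by rewrite (_ : [set _ | A 0] = setT) ?setIT; [apply: measurableC|apply/seteqP; split].
by rewrite (_ : [set _ | A 0] = set0) ?setI0; [exact: measurable0|apply/seteqP; split].
Qed.

(** A single finite index type for all 2m intervals turns preimages under T into finite unions of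
    translated sets. *)
Let piece (s : 'I_m + 'I_m) : set R :=
  match s with
  | inl i => `[sa i, sa i.+1[
  | inr i => `[al + sb i, al + sb i.+1[
  end.

Let shift (s : 'I_m + 'I_m) : R :=
  match s with inl i => sb i.+1 | inr i => - (al - sa i) end.

Let dsT_piece s x : piece s x -> T x = x + shift s.
Proof.
by case: s => i; rewrite /= in_itv => xi; [rewrite (@dsT_inA i)|rewrite (@dsT_inB i)].
Qed.

Let piece_I01 s x : piece s x -> 0 <= x < 1.
Proof.
by case: s => i /=; rewrite in_itv => xi; apply: piece_range;
  [apply: (@PieceA _ i)|apply: (@PieceB _ i)].
Qed.

Let piece_cover x : 0 <= x < 1 -> exists s, piece s x.
Proof.
by move=> /pieceP[] i xi; [exists (inl i)|exists (inr i)]; rewrite /= in_itv.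
Qed.

Let piece_inj s t x : piece s x -> piece t x -> s = t.
Proof.
case: s t => i [] j /=; rewrite !in_itv /= => xi xj.
- by rewrite (@inA_inj _ _ _ a_gt0 i j x).
- by move: (@inA_inBF i j x xi); rewrite /inB xj.
- by move: (@inA_inBF j i x xj); rewrite /inB xi.
- by rewrite (@inA_inj _ _ _ b_gt0 i j (x - al)) // -inBE.
Qed.

Let preimage_pieces S : I01 `&` T @^-1` S =
  \bigcup_s (piece s `&` (fun x => x + shift s) @^-1` S).
Proof.
apply/seteqP; split => x.
  move=> [/=]; rewrite in_itv /= => /piece_cover[s xs] Sx.
  by exists s => //; split => //=; rewrite -dsT_piece.
move=> [s _ [xs /=]]; rewrite -dsT_piece // => Sx; split => //=.
by rewrite in_itv /= (piece_I01 xs).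
Qed.

Let measurable_piece_preimage s S : measurable S ->
  measurable (piece s `&` (fun x => x + shift s) @^-1` S).
Proof.
move=> mS; apply: measurableI; first by case: s => i; exact: measurable_itv.
by rewrite -[X in measurable X]setTI; exact: measurable_translation.
Qed.

Lemma measurable_dsT_preimage S : measurable S -> measurable (I01 `&` T @^-1` S).
Proof.
move=> mS; rewrite preimage_pieces.
apply: fin_bigcup_measurable => // s _; exact: measurable_piece_preimage.
Qed.

Lemma lebesgue_dsT_preimage_le S : measurable S ->
  (lebesgue_measure (I01 `&` T @^-1` S) <= lebesgue_measure (I01 `&` S))%E.
Proof.
(* [G s] is the part of S in the image of [piece s]. Its preimage in that piece is a translate of
   it, and the sets [G s] are disjoint by injectivity of T, so their measures add up to at most that
   of S in [0, 1). *)
move=> mS; pose G s := (fun y => y - shift s) @^-1` piece s `&` S.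
have mG s : measurable (G s).
  apply: measurableI => //; rewrite -[X in measurable X]setTI.
  by apply: measurable_translation => //; case: s => i; exact: measurable_itv.
have GE s : piece s `&` (fun x => x + shift s) @^-1` S = (fun x => x + shift s) @^-1` G s.
  by apply/seteqP; split => x /=; rewrite /G /= addrK.
have Gx s y : G s y -> [/\ piece s (y - shift s), T (y - shift s) = y & S y].
  by case=> ys Sy; split => //; rewrite (dsT_piece ys) subrK.
have trG : trivIset setT G.
  move=> s t _ _ [y [/Gx[ys Ty _] /Gx[yt Ty' _]]].
  have yst : y - shift s = y - shift t.
    by apply: dsT_inj; [exact: piece_I01 ys|exact: piece_I01 yt|rewrite Ty].
  by apply: (piece_inj ys); rewrite yst.
apply: (@le_trans _ _ (\sum_(s \in setT) lebesgue_measure (G s))%E).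
  rewrite (eq_fsbigr (fun s => lebesgue_measure (piece s `&` (fun x => x + shift s) @^-1` S))).
    apply: content_sub_fsum; last by rewrite preimage_pieces.
    - exact: (@finite_finset ('I_m + 'I_m)%type).
    - by move=> s _; exact: measurable_piece_preimage.
    - exact: measurable_dsT_preimage.
  by move=> s _; rewrite GE lebesgue_measure_translation.
rewrite -measure_fin_bigcup //;
  [|exact: (@finite_finset ('I_m + 'I_m)%type)|by move=> s _; exact: mG].
apply: le_measure; rewrite ?inE; [| |].
- by apply: fin_bigcup_measurable => [|s _];
    [exact: (@finite_finset ('I_m + 'I_m)%type)|exact: mG].
- by apply: measurableI; first exact: measurable_itv.
move=> y [s _ /Gx[ys <- Sy]]; split => //=; rewrite in_itv /=.
exact/dsT_range/piece_I01/ys.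
Qed.

(* The inequality for S and for its complement, whose measures add up to 1, forces
   equality; surjectivity of T is thus never needed. *)
Lemma lebesgue_dsT_preimage S : measurable S ->
  lebesgue_measure (I01 `&` T @^-1` S) = lebesgue_measure (I01 `&` S).
Proof.
move=> mS; have mI : measurable I01 by exact: measurable_itv.
have lebI : lebesgue_measure I01 = 1%E.
  by rewrite lebesgue_measure_itv /= lte_fin ltr01 -EFinD subr0.
have split_leb X : measurable (I01 `&` X) ->
    (1 = lebesgue_measure (I01 `&` ~` X) + lebesgue_measure (I01 `&` X) :> \bar R)%E.
  move=> mX; have : (lebesgue_measure I01 = lebesgue_measure (I01 `\` (I01 `&` X)) +
    lebesgue_measure (I01 `&` (I01 `&` X)))%E := measureDI lebesgue_measure mI mX.
  by rewrite lebI setDIr setDv set0U setDE setIA setIid.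
have := split_leb _ (measurableI _ _ mI mS).
have := split_leb _ (measurable_dsT_preimage mS).
have := lebesgue_dsT_preimage_le mS.
have := lebesgue_dsT_preimage_le (measurableC mS).
rewrite preimage_setC.
have fin X : measurable (I01 `&` X) -> lebesgue_measure (I01 `&` X) \is a fin_num.
  move=> mX; rewrite ge0_fin_numE //.
  apply: (@le_lt_trans _ _ (lebesgue_measure I01)).
    by apply: le_measure; rewrite ?inE.
  by rewrite lebI ltry.
have mSC := measurableC mS.
have := fin _ (measurableI _ _ mI mS); have := fin _ (measurableI _ _ mI mSC).
have := fin _ (measurable_dsT_preimage mS); have := fin _ (measurable_dsT_preimage mSC).
rewrite preimage_setC.
move: (lebesgue_measure _) (lebesgue_measure _) (lebesgue_measure _) (lebesgue_measure _).
case=> [u||] // [v||] // [w||] // [t||] // _ _ _ _.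
rewrite !lee_fin -!EFinD => h1 h2 [e1] [e2]; congr (_%:E); lra.
Qed.

(** Reduces invariance of an image measure under doubling to invariance of the original measure
    under T. *)
Lemma Hl_preimage_E2 A : H @^-1` (@E2 R @^-1` A) = T @^-1` (H @^-1` A).
Proof. by apply/seteqP; split => x /=; rewrite E2_Hl. Qed.

(** * Atoms of the image measure *)

Lemma fiber_is_interval z : is_interval (I01 `&` H @^-1` [set z]).
Proof.
move=> x y [/=]; rewrite !in_itv /= => x01 Hx [y01 Hy] t /andP[xt ty].
have t01 : 0 <= t < 1 by lra.
split; rewrite /= ?in_itv //=; apply/eqP.
by rewrite eq_le -{1}Hy -{1}Hx !Hl_le.
Qed.

(** A fibre with at most one point is a null set, while one with points x < y contains [x, y]
    because it is an interval. *)
Lemma muL_gt0P z : (0 < muL a b [set z])%E <->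
  exists x y, (I01 `&` H @^-1` [set z]) x /\ (I01 `&` H @^-1` [set z]) y /\ x < y.
Proof.
have mJ := measurable_realfun.is_interval_measurable (@fiber_is_interval z).
rewrite /muL /pushforward; split=> [|[x [y [Jx [Jy xy]]]]].
  apply: contraPP => noJ; apply/negP; rewrite -leNgt.
  have [[x Jx]|J0] := pselect (exists x, (I01 `&` H @^-1` [set z]) x).
    rewrite (_ : _ `&` _ = [set x]) ?lebesgue_measure_set1 //.
    apply/seteqP; split => [y Jy|_ -> //] /=; apply/eqP; rewrite eq_le !leNgt.
    by apply/andP; split; apply/negP => xy; apply: noJ; [exists x, y|exists y, x].
  rewrite (_ : _ `&` _ = set0) ?measure0 //; apply/seteqP; split => // x Jx.
  by apply: J0; exists x.
apply: (@lt_le_trans _ _ (lebesgue_measure `[x, y])).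
  by rewrite lebesgue_measure_itv /= lte_fin xy -EFinD lte_fin subr_gt0.
apply: le_measure; rewrite ?inE //.
by move=> t /=; rewrite in_itv /=; exact: (@fiber_is_interval z x y Jx Jy).
Qed.

End DeckShuffler.

Theorem theorem4 (R : realType) (m : nat) (a b : 'I_m -> R) :
  valid_lengths a b ->
  let T := dsT a b in
  let H := Hl a b in
  let I01 := `[(0:R), 1[%classic in
  (* (a) *)
  (forall x, 0 <= x < 1 -> E2 (H x) = H (T x)) /\
  (* (b) *)
  (forall A : set R, measurable A ->
     muL a b (@E2 R @^-1` A) = muL a b A) /\
  (forall nu : probability R R, nu I01 = 1%E ->
     (forall A : set R, measurable A -> nu (T @^-1` A) = nu A) ->
     forall A : set R, measurable A ->
       pushforward nu H (@E2 R @^-1` A) = pushforward nu H A) /\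
  (* (c) *)
  (forall x, 0 <= x < 1 -> H y @[y --> x^'+] --> H x) /\
  (* (d) *)
  (forall x y, 0 <= x -> x <= y -> y < 1 -> H x <= H y) /\
  (* (e) *)
  (forall z, 0 <= z < 1 ->
     ((0 < muL a b [set z])%E <->
        (is_interval (I01 `&` H @^-1` [set z]) /\
         exists x y, (I01 `&` H @^-1` [set z]) x /\
                     (I01 `&` H @^-1` [set z]) y /\ x < y)) /\
     ((0 < muL a b [set z])%E ->
        exists n : nat, (0 < n)%N /\
          forall x, (I01 `&` H @^-1` [set z]) x -> iter n T x = x)) /\
  (forall c d, 0 <= c -> c < d -> d < 1 ->
     (exists n : nat, (0 < n)%N /\ forall x, c <= x <= d -> iter n T x = x) ->
     finite_set (H @` `[c, d])) /\
  (* (f) *)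
  (minimalT a b ->
     (forall x y, 0 <= x -> x < y -> y < 1 -> H x < H y) /\
     {in I01 &, injective H}).
Proof.
move=> lengths_ab T H I01.
split; first by move=> x _; exact: E2_Hl.
split.
  move=> A mA; rewrite /muL /pushforward Hl_preimage_E2 //.
  apply: lebesgue_dsT_preimage => //; exact: measurable_Hl_preimageT.
split.
  move=> nu _ nuT A mA; rewrite /pushforward Hl_preimage_E2 // nuT //.
  exact: measurable_Hl_preimageT.
split; first by move=> x; exact: Hl_right_continuous.
split.
  by move=> x y x0 xy y1; apply: Hl_le => //; lra.
split.
  move=> z _; split.
    rewrite muL_gt0P //; split=> [J|[]//]; split => //; exact: fiber_is_interval.
  move/(muL_gt0P lengths_ab) => [x [y [[x01 Hx] [[y01 Hy] xy]]]].
  rewrite /= in_itv /= in x01 y01.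
  have [p p0 Tp] := plateau_periodic lengths_ab x01 y01 xy (etrans Hx (esym Hy)).
  exists p; split => // t [t01 Ht]; rewrite /I01 /= in_itv /= in t01.
  by apply: Tp => //; rewrite [RHS]Hx.
split.
  by move=> c d _ _ _ [n [n0 Tn]]; exact: periodic_Hl_finite n0 Tn.
move=> min.
have lt x y : 0 <= x -> x < y -> y < 1 -> H x < H y.
  by move=> x0 xy y1; apply: minimal_Hl_lt => //; lra.
split => // x y; rewrite !inE /I01 /= !in_itv /= => /andP[x0 x1] /andP[y0 y1] Hxy.
by case: (ltgtP x y) => // [/(lt _ _ x0)/(_ y1)|/(lt _ _ y0)/(_ x1)]; rewrite Hxy ltxx.
Qed.
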